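(* Let $a$ and $d$ be positive integers. The set $\mathcal{M}_a(d)$ of $a$-floor multiples of $d$ is a numerical semigroup. It has the following properties. (1) The largest integer not in $\mathcal{M}_a(d)$, its Frobenius number, is $(d-1)(ad+1)$. (2) The number of positive integers not in $\mathcal{M}_a(d)$ is $\frac12 (d-1)(ad+2)$. (3) The minimal generating set of $\mathcal{M}_a(d)$ is $\{\gamma_0, \gamma_1, \ldots, \gamma_{d-1}\}$, where $$\gamma_j = (ja+1)d + j = j(ad+1) + d \quad \text{for } 0 \le j \le d-1.$$
   Context: $\mathbb{N}^+ = \{1,2,3,\ldots\}$. For positive integers $d, n$, one writes $d \preccurlyeq_1 n$ if $d = \lfloor n/k \rfloor$ for some positive integer $k$. For an integer $a \ge 1$, one writes $d \preccurlyeq_a n$ if and only if $ad \preccurlyeq_1 an$, i.e. there is a positive integer $k$ with $ad = \lfloor an/k \rfloor$; then $n$ is called an $a$-floor multiple of $d$. The set of $a$-floor multiples of $d$ is $\mathcal{M}_a(d) := \{n \in \mathbb{N}^+ : d \preccurlyeq_a n\}$. A numerical semigroup here is a subset of $\mathbb{N}^+$ that is closed under addition and contains all but finitely many elements of $\mathbb{N}^+$. A generating set is a subset such that every element of the semigroup is a sum of one or more (not necessarily distinct) elements of the subset; the minimal generating set is the generating set no strict subset of which generates the semigroup. The Frobenius number is the largest integer not belonging to the semigroup (so for $d=1$, where $\mathcal{M}_a(1) = \mathbb{N}^+$, it is $0$). *)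

(* Defs.v *)
From mathcomp Require Import all_boot all_order all_algebra.
From mathcomp Require Import finmap.
From mathcomp Require Import boolp classical_sets functions cardinality.
Set Implicit Arguments.
Unset Strict Implicit.
Unset Printing Implicit Defensive.
Import Order.TTheory GRing.Theory Num.Theory.
Local Open Scope classical_set_scope.

Definition floor_div1 (d n : nat) : Prop := exists2 k, 0 < k & d = n %/ k.

Definition floor_div (a d n : nat) : Prop := floor_div1 (a * d) (a * n).

Definition floor_multiples (a d : nat) : set nat :=
  [set n | 0 < n /\ floor_div a d n].

(* Positive integers outside [S]: subsets of N^+ are represented in [nat], so
   0 must be excluded explicitly. *)
Definition gaps (S : set nat) : set nat := [set n | 0 < n /\ ~ S n].

Record numerical_semigroup (S : set nat) : Prop := NumericalSemigroup {
  ns_pos : forall n, S n -> 0 < n;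
  ns_add : forall m n, S m -> S n -> S (m + n);
  ns_cofinite : finite_set (gaps S)
}.

(* The maximum is taken over all integers, and 0 is never in a subset of N^+:
   the Frobenius number of N^+ itself is 0. *)
Definition is_frobenius_number (S : set nat) (f : int) : Prop :=
  ~ (Posz @` S) f /\ forall z : int, ~ (Posz @` S) z -> (z <= f)%R.

(* Sums of one or more terms: the empty sum is not allowed. *)
Definition is_sum_of (A : set nat) (n : nat) : Prop :=
  exists s : seq nat,
    [/\ s != [::], forall x, x \in s -> A x & n = \sum_(x <- s) x].

Definition generating_set (S A : set nat) : Prop :=
  A `<=` S /\ forall n, S n -> is_sum_of A n.

Definition minimal_generating_set (S A : set nat) : Prop :=
  generating_set S A /\ forall B : set nat, B `<` A -> ~ generating_set S B.

Definition gamma (a d j : nat) : nat := (j * a + 1) * d + j.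

(* Main.v *)
Require Import Defs.
From mathcomp Require Import all_boot all_order all_algebra.
From mathcomp Require Import finmap.
From mathcomp Require Import boolp classical_sets functions cardinality.
From mathcomp Require Import zify.
Set Implicit Arguments.
Unset Strict Implicit.
Unset Printing Implicit Defensive.
Import Order.TTheory GRing.Theory Num.Theory.
Local Open Scope classical_set_scope.

(** Unfolding [a * d = a * n %/ k] gives [a * d * k <= a * n < (a * d + 1) * k].
    Cancelling [a] on the left and writing [n = k * d + s], this says that [n]
    is an [a]-floor multiple of [d] exactly when [n = k * d + s] for some
    naturals [k] and [s] with [a * s < k] ([floor_multiplesP]). When [d <= s],
    replacing [s] by [s - d] and [k] by [k + 1] preserves the condition, so that
    Euclidean division is the best such decomposition: the membership test
    becomes [a * (n %% d) < n %/ d] ([floor_multiplesE]). The rest is read off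
    from these two descriptions.

    Closure under addition is clear, since the inequality [a * s < k] is
    additive in the pair [(k, s)]. The gaps in the residue class [r] are the
    numbers [q * d + r] with [q <= a * r]. The class of [r = 0] contributes no
    positive gap, every other class contributes [a * r + 1] of them, and the
    largest non-multiple has [r = d - 1] and [q = a * (d - 1)].

    In the residue class [r] the least floor multiple is
    [gamma a d r = (a * r + 1) * d + r], and the others are obtained from it by
    adding copies of [d = gamma a d 0]; hence the [gamma]s generate. Each of
    them is indecomposable, because integrality turns the strict inequalities
    [a * s < k] of two summands into [a * s + 2 <= k] for their sum
    ([gamma_indecomposable]). Indecomposable elements belong to every generating
    set, so a generating set made of them is the only minimal one
    ([minimal_generating_setE]). *)

(** * Generating sets made of indecomposable elements *)

(** A sum of elements of [A] with at least two terms splits into its first term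
    and the rest, both in [S]; so an indecomposable element can only be a sum
    with one term. *)
Lemma indecomposable_generator (S A : set nat) (x : nat) :
    (forall m n, S m -> S n -> S (m + n)) -> generating_set S A ->
    S x -> (forall y z, S y -> S z -> x <> y + z) ->
  A x.
Proof.
move=> addS [AS genA] Sx irr_x.
have sumS y s : S y -> {in s, forall z, S z} -> S (y + \sum_(z <- s) z).
  elim: s y => [|z s IHs] y Sy Ss; first by rewrite big_nil addn0.
  rewrite big_cons addnA; apply: IHs => [|t st].
    by apply: addS => //; apply: Ss; rewrite mem_head.
  by apply: Ss; rewrite in_cons st orbT.
have [[|y [|z s]] [// _ sA xE]] := genA _ Sx.
  by rewrite xE big_seq1; apply: sA; rewrite mem_head.
exfalso; apply: (irr_x y (z + \sum_(t <- s) t)); last by rewrite xE !big_cons.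
  by apply/AS/sA; rewrite mem_head.
apply: sumS => [|t st]; apply/AS/sA; rewrite !in_cons ?eqxx ?st ?orbT //.
Qed.

(** [G] lies in every generating set [B]: for [B = A] minimal this forces
    [A = G], and for [B] strictly inside [G] it is absurd. *)
Lemma minimal_generating_setE (S G : set nat) :
    (forall m n, S m -> S n -> S (m + n)) -> generating_set S G ->
    (forall x y z, G x -> S y -> S z -> x <> y + z) ->
  forall A, minimal_generating_set S A <-> A = G.
Proof.
move=> addS genG irrG A.
have GsubA B : generating_set S B -> G `<=` B.
  move=> genB x Gx; apply: (indecomposable_generator addS genB).
    exact: genG.1.
  by move=> y z; apply: irrG.
split=> [[genA minA]|->].
  apply/seteqP; split; last exact: GsubA.
  by apply: contrapT => AG; apply: (minA G); last exact: genG;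
    split=> //; apply: GsubA.
by split=> // B [_ GB] genB; apply: GB; apply: GsubA.
Qed.

(** * Membership in the set of floor multiples *)

Section FloorMultiples.
Variables a d : nat.
Hypotheses (a_gt0 : 0 < a) (d_gt0 : 0 < d).

Local Notation M := (floor_multiples a d).

Lemma floor_multiplesP n :
  M n <-> exists k s, n = k * d + s /\ a * s < k.
Proof.
split=> [[n_gt0 [k k_gt0 adE]]|[k [s [-> ltk]]]].
  have le_kd : k * d <= n.
    rewrite -(leq_pmul2l a_gt0) mulnCA mulnC adE; exact: leq_divM.
  exists k, (n - k * d); split; first by rewrite subnKC.
  have := ltn_ceil (a * n) k_gt0; rewrite -adE.
  by rewrite mulnBr; nia.
have k_gt0 : 0 < k by apply: leq_ltn_trans ltk.
split; first by rewrite addn_gt0 muln_gt0 k_gt0 d_gt0.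
exists k => //.
by rewrite mulnDr mulnCA (mulnC k) divnMDl ?divn_small ?addn0.
Qed.

Lemma floor_multiplesE n : M n <-> a * (n %% d) < n %/ d.
Proof.
rewrite floor_multiplesP; split=> [[k [s [-> ltk]]]|lt_n].
  (* The carry s %/ d only helps: it moves from the remainder to the quotient. *)
  rewrite modnMDl divnMDl //; apply: leq_trans (leq_addr _ _).
  by apply: leq_ltn_trans ltk; rewrite leq_mul2l leq_mod orbT.
by exists (n %/ d), (n %% d); rewrite -divn_eq.
Qed.

Lemma floor_multiplesD m n : M m -> M n -> M (m + n).
Proof.
move=> /floor_multiplesP[k [s [-> lts]]] /floor_multiplesP[l [t [-> ltt]]].
by apply/floor_multiplesP; exists (k + l), (s + t); split; lia.
Qed.

(** * Gaps *)

(** The remainder 0 is left out because its only non-multiple is 0, which is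
    not a gap. *)
Definition gap_seq : seq nat :=
  [seq q * d + r | r <- iota 1 d.-1, q <- iota 0 (a * r).+1].

Lemma gapsE : gaps M = [set` gap_seq].
Proof.
apply/seteqP; split=> n /=.
  move=> [n_gt0 /floor_multiplesE/negP]; rewrite -leqNgt => le_n.
  apply/allpairsPdep; exists (n %% d), (n %/ d).
  rewrite !mem_iota -divn_eq add0n ltnS le_n add1n prednK // ltn_mod d_gt0.
  rewrite andbT lt0n; split=> //.
  apply/eqP => r0; move: le_n n_gt0.
  by rewrite {3}(divn_eq n d) r0 muln0 leqn0 => /eqP->.
move=> /allpairsPdep[r [q [+ + ->]]].
rewrite !mem_iota add1n prednK // add0n ltnS => /andP[r_gt0 lt_rd] /andP[_ le_q].
split; first by rewrite addn_gt0 r_gt0 orbT.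
move/floor_multiplesE; rewrite modnMDl divnMDl // (modn_small lt_rd).
by rewrite (divn_small lt_rd) addn0 ltnNge le_q.
Qed.

Lemma uniq_gap_seq : uniq gap_seq.
Proof.
apply: allpairs_uniq_dep => [|r _|]; rewrite ?iota_uniq //.
move=> _ _ /allpairsPdep[r [q [+ _ ->]]] /allpairsPdep[r' [q' [+ _ ->]]] /=.
rewrite !mem_iota add1n prednK // => /andP[_ ltr] /andP[_ ltr'] eq_n.
have := congr1 (modn^~ d) eq_n; have := congr1 (divn^~ d) eq_n.
by rewrite /= !modnMDl !divnMDl // !modn_small // !divn_small // !addn0 => -> ->.
Qed.

Lemma size_gap_seq : 2 * size gap_seq = d.-1 * (a * d + 2).
Proof using d_gt0.
clear a_gt0; rewrite size_allpairs_dep; under eq_map do rewrite size_iota.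
case: d d_gt0 => // m _ /=.
elim: m => // m IHm; rewrite -{1}(addn1 m) iotaD map_cat sumn_cat mulnDr IHm /=; lia.
Qed.

Lemma card_gaps : #|` fset_set (gaps M)| = size gap_seq.
Proof.
have -> : gaps M = [set` [fset x in gap_seq]%fset].
  by rewrite gapsE; apply/seteqP; split=> x /=; rewrite !inE.
by rewrite set_fsetK card_fseq undup_id // uniq_gap_seq.
Qed.

Lemma numerical_semigroup_floor_multiples : numerical_semigroup M.
Proof.
split=> [n []//||]; first exact: floor_multiplesD.
by rewrite gapsE; apply: finite_seq.
Qed.

Lemma frobenius_floor_multiples :
  is_frobenius_number M (Posz (d.-1 * (a * d + 1))).
Proof.
have frobE : d.-1 * (a * d + 1) = a * d.-1 * d + d.-1 by nia.
have lt_pd : d.-1 < d by rewrite prednK.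
split=> [[n Mn [nE]]|[n|n] notM]; last by [].
  move/floor_multiplesE: Mn; rewrite nE frobE modnMDl divnMDl //.
  by rewrite modn_small // divn_small // addn0 ltnn.
have : ~ M n by move=> Mn; apply: notM; exists n.
move/floor_multiplesE/negP; rewrite -leqNgt => le_n.
rewrite lez_nat frobE (divn_eq n d).
have le_r : n %% d <= d.-1 by rewrite -ltnS prednK // ltn_mod.
apply: leq_add => //; rewrite leq_mul2r; apply/orP; right.
by apply: leq_trans le_n _; rewrite leq_mul2l le_r orbT.
Qed.

(** * Generators *)

Lemma gamma_floor_multiple j : M (gamma a d j).
Proof. by apply/floor_multiplesP; exists (j * a + 1), j; split=> //; lia. Qed.

Lemma gamma_generating : generating_set M [set gamma a d j | j in `I_d].
Proof.
split=> [_ [j _ <-]|n]; first exact: gamma_floor_multiple.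
move/floor_multiplesE => lt_n.
(* n is the least floor multiple in its residue class plus copies of d. *)
exists (gamma a d (n %% d) :: nseq (n %/ d - (a * (n %% d)).+1) (gamma a d 0)).
split=> // [x|].
  rewrite in_cons => /predU1P[->|/nseqP[-> _]] /=; last by exists 0.
  by exists (n %% d) => //=; rewrite ltn_mod.
rewrite big_cons big_nseq iter_addn_0 {1}(divn_eq n d) /gamma mul0n add0n.
by rewrite mul1n addn0 -{1}(subnKC lt_n) mulnDl; lia.
Qed.

(** If [gamma a d j] decomposes with total multiplier [K] and total offset [s],
    then [K * d + s = (a * j + 1) * d + j] and [a * s + 2 <= K]. Either
    [K <= a * j + 1], so [s >= j] and [K >= a * j + 2], or [K >= a * j + 2], so
    [K * d] exceeds [gamma a d j] as [j < d]: both are absurd. *)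
Lemma gamma_indecomposable j y z :
  j < d -> M y -> M z -> gamma a d j <> y + z.
Proof.
move=> lt_jd /floor_multiplesP[k [s [-> lts]]] /floor_multiplesP[l [t [-> ltt]]].
rewrite /gamma => eq_g.
have [le_K|lt_K] := leqP (k + l) (j * a + 1).
  have le_Kd : (k + l) * d <= (j * a + 1) * d by rewrite leq_mul2r le_K orbT.
  have le_js : j <= s + t by lia.
  have : a * j <= a * (s + t) by rewrite leq_mul2l le_js orbT.
  by lia.
have : (j * a + 2) * d <= (k + l) * d by rewrite leq_mul2r; lia.
by lia.
Qed.

End FloorMultiples.

Theorem theorem1p8 (a d : nat) (ha : 0 < a) (hd : 0 < d) :
  [/\ numerical_semigroup (floor_multiples a d),
      is_frobenius_number (floor_multiples a d)
        ((d%:Z - 1) * (a%:Z * d%:Z + 1))%R,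
      (#|` fset_set (gaps (floor_multiples a d))|%:R
         = 2^-1 * (d%:R - 1) * (a%:R * d%:R + 2) :> rat)%R,
      (forall A : set nat,
         minimal_generating_set (floor_multiples a d) A
           <-> A = [set gamma a d j | j in `I_d])
    & (forall j, j < d -> gamma a d j = j * (a * d + 1) + d)].
Proof.
split.
- exact: numerical_semigroup_floor_multiples.
- have -> : ((d%:Z - 1) * (a%:Z * d%:Z + 1))%R = Posz (d.-1 * (a * d + 1)).
    by rewrite PoszM PoszD PoszM -{1}(prednK hd) -addn1 PoszD addrK.
  exact: frobenius_floor_multiples.
- have d1E : (d%:R - 1 = d.-1%:R :> rat)%R.
    by rewrite -{1}(prednK hd) -natr1 addrK.
  rewrite card_gaps // d1E -mulrA -natrM -natrD -natrM -(size_gap_seq a hd).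
  by rewrite natrM mulKf.
- apply: minimal_generating_setE; first exact: floor_multiplesD.
    exact: gamma_generating.
  by move=> _ y z [j lt_jd <-]; apply: gamma_indecomposable.
- by move=> j _; rewrite /gamma; lia.
Qed.
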